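(* Let $M_-,M_+\in\mathbb{Z}$ with $M:=M_-+M_+\geq 0$. For every $\ell\in\{-M_-,\dots,M_+\}$, the $M$ roots of the degree-$M$ polynomial $\alpha_{R_1,M_-,M_+,\ell}(\xi)$ are all real and distinct, and there is exactly one root in each open interval $(n-\tfrac12,n+\tfrac12)$, $n\in\{-M_-,\dots,M_+\}\setminus\{\ell\}$. That is, for all $\ell\in\{-M_-,\dots,M_+\}$ and all $n\in\{-M_-,\dots,M_+\}\setminus\{\ell\}$, $$\exists!\;\xi_{R_1,M_-,M_+,\ell,n}\in(n-\tfrac12,n+\tfrac12)\subset\mathbb{R}\;:\;\alpha_{R_1,M_-,M_+,\ell}(\xi_{R_1,M_-,M_+,\ell,n})=0,$$ and for all $\ell\in\{-M_-,\dots,M_+\}$ $$\alpha_{R_1,M_-,M_+,\ell}(\xi)\neq0\qquad\forall\,\xi\in\mathbb{R}\setminus\bigl\{\xi_{R_1,M_-,M_+,\ell,n}\;;\;n\in\{-M_-,\dots,M_+\}\setminus\{\ell\}\bigr\}.$$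
   Context: For integers $M_\pm$ (of either sign) with $M:=M_-+M_+\ge0$ and $\ell\in\{-M_-,\dots,M_+\}$, the fundamental polynomial of Lagrange interpolation is $$\alpha_{I,M_-,M_+,\ell}(\xi)=\prod_{k=-M_-,\,k\neq\ell}^{M_+}\frac{\xi-k}{\ell-k}=\sum_{m=0}^{M}a_{m,\ell}\,\xi^m ,$$ which defines the coefficients $a_{m,\ell}$ (the entries of the inverse Vandermonde matrix on the nodes $-M_-,\dots,M_+$). The fundamental polynomial of Lagrange reconstruction is $$\alpha_{R_1,M_-,M_+,\ell}(\xi):=\sum_{m=0}^{M}\Bigl(\sum_{k=0}^{\lfloor (M-m)/2\rfloor}\frac{\tau_{2k}\,(m+2k)!}{m!}\,a_{m+2k,\ell}\Bigr)\xi^m ,$$ where $\tau_0=1$ and $\tau_{2k}=-\sum_{s=0}^{k-1}\dfrac{\tau_{2s}}{2^{2k-2s}(2k-2s+1)!}$ for $k\geq1$. *)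

(* Defs.v *)
From mathcomp Require Import all_boot all_order all_algebra.

Set Implicit Arguments.
Unset Strict Implicit.
Unset Printing Implicit Defensive.

Import Order.TTheory GRing.Theory Num.Theory.
Local Open Scope ring_scope.

(* M = M_- + M_+ as a natural number; only meaningful when 0 <= Mm + Mp. *)
Definition stencil_order (Mm Mp : int) : nat := absz (Mm + Mp).

(* The increasing list -M_-, ..., M_+ (when 0 <= Mm + Mp). *)
Definition nodes (Mm Mp : int) : seq int :=
  [seq i%:Z - Mm | i <- iota 0 (stencil_order Mm Mp).+1].

Lemma mem_nodes (Mm Mp k : int) :
  0 <= Mm + Mp -> (k \in nodes Mm Mp) = (- Mm <= k <= Mp).
Proof.
move=> M0; have EM : (absz (Mm + Mp) : int) = Mm + Mp by rewrite gez0_abs.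
apply/mapP/andP => [[i] | [h1 h2]].
  rewrite mem_iota add0n ltnS /= => hi ->; split.
    by rewrite addrC lerDl.
  by rewrite lerBlDl -EM lez_nat.
have hk : (absz (k + Mm) : int) = k + Mm by rewrite gez0_abs // -(subrK Mm 0) sub0r lerD2r.
exists (absz (k + Mm)); last by rewrite hk addrK.
by rewrite mem_iota add0n ltnS /= -lez_nat hk EM addrC lerD2l.
Qed.

Section Lagrange.
Variable F : fieldType.

Definition lagrange_interp (Mm Mp l : int) : {poly F} :=
  \prod_(k <- nodes Mm Mp | k != l) ((l - k)%:~R^-1 *: ('X - k%:~R%:P)).

(* tau_list k = [:: tau_0; tau_2; ...; tau_(2k)] *)
Fixpoint tau_list (k : nat) : seq F :=
  if k is j.+1 then
    rcons (tau_list j)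
      (- \sum_(s < k) (tau_list j)`_s
           / (2 ^+ (2 * k - 2 * s) * ((2 * k - 2 * s + 1)`!)%:R))
  else [:: 1].

(* Only even indices occur: tau_even k is tau_(2k). *)
Definition tau_even (k : nat) : F := (tau_list k)`_k.

Lemma size_tau_list k : size (tau_list k) = k.+1.
Proof. by elim: k => //= k IH; rewrite size_rcons IH. Qed.

Lemma nth_tau_list k s : (s <= k)%N -> (tau_list k)`_s = tau_even s.
Proof.
elim: k => [|k IH]; first by rewrite leqn0 => /eqP->.
rewrite leq_eqVlt => /orP[/eqP-> //|]; rewrite ltnS => hs.
by rewrite /= nth_rcons size_tau_list ltnS hs IH.
Qed.

Lemma tau_even0 : tau_even 0 = 1.
Proof. by []. Qed.

Lemma tau_evenE k : (0 < k)%N ->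
  tau_even k = - \sum_(s < k) tau_even s
                   / (2 ^+ (2 * k - 2 * s) * ((2 * k - 2 * s + 1)`!)%:R).
Proof.
case: k => // k _; rewrite {1}/tau_even /= nth_rcons size_tau_list ltnn eqxx.
by congr (- _); apply: eq_bigr => s _; rewrite nth_tau_list // -ltnS.
Qed.

Definition lagrange_reconstr (Mm Mp l : int) : {poly F} :=
  let M := stencil_order Mm Mp in
  \poly_(m < M.+1)
    \sum_(k < ((M - m)./2).+1)
      tau_even k * ((m + 2 * k)`!)%:R / (m`!)%:R
        * (lagrange_interp Mm Mp l)`_(m + 2 * k).

End Lagrange.

(* Main.v *)
(* The numbers tau_(2k) are the coefficients of the operator inverse to
   averaging over a unit cell: the mean of f over [x - 1/2, x + 1/2] is
   sum_k f^(2k)(x) / (2^(2k) (2k+1)!), and the recursion for tau says that the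
   two even power series in d/dx are mutually inverse. So the cell averages of
   the reconstruction polynomial are the values of the interpolation
   polynomial, which vanish at every node n <> l. An antiderivative therefore
   takes equal values at n - 1/2 and n + 1/2, and Rolle's theorem gives a root
   in each of these M disjoint cells; the degree is M, so there is no other. *)
Require Import Defs.
From mathcomp Require Import all_boot all_order all_algebra.
From mathcomp Require Import reals zify ring lra.
From mathcomp.real_closed Require Import polyrcf complex.

Import Order.TTheory GRing.Theory Num.Theory.
Local Open Scope ring_scope.

(** The coefficient of [t^(2k)] in [sinh(t/2)/(t/2)]; the [tau_even k] are those of the reciprocal
    series. *)
Definition cell_coef (F : fieldType) (k : nat) : F :=
  (2 ^+ (2 * k) * ((2 * k + 1)`!)%:R)^-1.

Lemma tau_cell_convol (F : fieldType) (i : nat) :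
  \sum_(s < i.+1) tau_even F s * cell_coef F (i - s) = (i == 0)%N%:R.
Proof.
rewrite big_ord_recr /= subnn /cell_coef muln0 expr0 mul1r invr1 mulr1.
case: i => [|i]; first by rewrite big_ord0 add0r tau_even0.
rewrite (@tau_evenE F i.+1) //.
by under eq_bigr => s _ do rewrite mulnBr; rewrite subrr.
Qed.

Definition even_deconvol (F : fieldType) (q : {poly F}) (N : nat) : {poly F} :=
  \sum_(j < N) tau_even F j *: q^`(2 * j).

Lemma derivn_derivn (R : nzRingType) (p : {poly R}) (m n : nat) :
  p^`(m + n) = (p^`(n))^`(m).
Proof. exact: iterD. Qed.

(** Collecting the double sum by total order [2 * i] turns the coefficients into the convolution of
    the two series, which leaves only [i = 0]. *)
Lemma cell_coef_even_deconvol (F : fieldType) (q : {poly F}) (N : nat) :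
  (size q <= N)%N ->
  \sum_(k < N) cell_coef F k *: (even_deconvol F q N)^`(2 * k) = q.
Proof.
move=> sq.
pose G i j := (tau_even F j * cell_coef F (i - j)) *: q^`(2 * i).
transitivity (\sum_(j < N) \sum_(i < N | (j <= i)%N) G i j).
  under eq_bigr => k _ do rewrite /even_deconvol linear_sum scaler_sumr.
  rewrite exchange_big; apply: eq_bigr => j _ /=.
  rewrite -(big_geq_mkord _ _ predT (fun i => G i j)).
  rewrite -[X in _ = \big[_/_]_(X <= _ < _ | _) _]add0n big_addn big_mkord.
  rewrite (big_ord_widen N (fun i => G (i + j)%N j)) ?leq_subr // [RHS]big_mkcond.
  apply: eq_bigr => i _.
  rewrite /G addnK derivnZ -derivn_derivn -mulnDr scalerA mulrC.
  (* The square of indices exceeds the triangle only by terms of total index at least [N], whose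
     derivatives of [q] vanish. *)
  case: ltnP; rewrite // leq_subLR addnC => h.
  by rewrite derivn_poly0 ?scaler0 // (leq_trans sq) // (leq_trans h) ?leq_pmull.
rewrite (exchange_big_dep xpredT) //.
transitivity (\sum_(i < N) (i == 0 :> nat)%N%:R *: q^`(2 * i)).
  apply: eq_bigr => i _; rewrite -tau_cell_convol scaler_suml.
  by rewrite (big_ord_widen N (fun j => G i j)) //; apply: ltn_ord.
case: N sq {G} => [|N] sq; first by rewrite big_ord0; apply/esym/eqP; rewrite -size_poly_leq0.
by rewrite big_ord_recl /= scale1r big1 ?addr0 // => i _; rewrite scale0r.
Qed.

(** Subtract the Taylor expansions at [x] with steps [1/2] and [-1/2]: even orders cancel, and order
    [2k+1] contributes [2 * (1/2)^(2k+1) / (2k+1)!], which is [cell_coef F k]. *)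
Lemma cell_difference (F : numFieldType) (P : {poly F}) (N : nat) (x : F) :
  (size P <= N.*2)%N ->
  P.[x + 2^-1] - P.[x - 2^-1] =
    \sum_(k < N) cell_coef F k * (P^`())^`(2 * k).[x].
Proof.
have pair (G : nat -> F) : \sum_(i < N.*2) G i = \sum_(k < N) (G k.*2 + G k.*2.+1).
  elim: N => [|N IH]; first by rewrite !big_ord0.
  by rewrite doubleS !big_ord_recr /= IH addrA.
move=> sP; rewrite !(nderiv_taylor_wide (mulrC _ _) sP) -sumrB.
rewrite (pair (fun i => P^`N(i).[x] * 2^-1 ^+ i - P^`N(i).[x] * (- 2^-1) ^+ i)).
apply: eq_bigr => k _; rewrite -mul2n -derivSn nderivn_def hornerMn /cell_coef.
rewrite addn1 !exprS !exprM sqrrN -mulr_natr.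
have f0 : (((2 * k).+1)`!)%:R != 0 :> F by rewrite pnatr_eq0 -lt0n fact_gt0.
by rewrite !exprVn; field; rewrite f0 !expf_neq0 // mul1r pnatr_eq0.
Qed.

(* The constant term is p`_0 / 0 = 0. *)
Definition antideriv (F : fieldType) (p : {poly F}) : {poly F} :=
  \poly_(i < (size p).+1) (p`_i.-1 / i%:R).

Lemma deriv_antideriv (F : numFieldType) (p : {poly F}) :
  (antideriv F p)^`() = p.
Proof.
apply/polyP => i; rewrite coef_deriv coef_poly ltnS.
case: ltnP => [_|h]; last by rewrite mul0rn nth_default.
by rewrite -[LHS]mulr_natr divfK // pnatr_eq0.
Qed.

(** The factor [(m+2k)!/m!] comes from differentiating [2k] times; the cutoff at half of [M - m]
    drops only coefficients of [q] beyond its size. *)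
Lemma lagrange_reconstrE (F : numFieldType) (Mm Mp l : int) :
  let M := stencil_order Mm Mp in
  (size (lagrange_interp F Mm Mp l) <= M.+1)%N ->
  lagrange_reconstr F Mm Mp l =
    even_deconvol F (lagrange_interp F Mm Mp l) M.+1.
Proof.
move=> M; set q := lagrange_interp _ _ _ _ => sq.
apply/polyP => m; rewrite coef_poly -/M -/q coef_sum.
case: ltnP => hm.
  pose G k := tau_even F k * ((m + 2 * k)`!)%:R / (m`!)%:R * q`_(m + 2 * k).
  rewrite (big_ord_widen M.+1 G); last by lia.
  rewrite big_mkcond; apply: eq_bigr => j _; rewrite coefZ coef_derivn /G.
  rewrite (addnC m); move: (nat_of_ord j) => {}j.
  case: ltnP => hj; last by rewrite nth_default ?mul0rn ?mulr0 // (leq_trans sq) //; lia.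
  rewrite -[in LHS](@ffact_fact (2 * j + m) (2 * j)) ?leq_addr // addKn natrM.
  by rewrite !mulrA mulfK ?pnatr_eq0 -?lt0n ?fact_gt0 // -mulrA mulr_natl.
rewrite big1 // => j _.
by rewrite coefZ coef_derivn nth_default ?mul0rn ?mulr0 // (leq_trans sq) // (leq_trans hm) ?leq_addl.
Qed.

Lemma nodes_uniq (Mm Mp : int) : uniq (nodes Mm Mp).
Proof.
by rewrite map_inj_uniq ?iota_uniq // => i j /addIr /eqP; rewrite eqz_nat => /eqP.
Qed.

Lemma size_nodes_other (Mm Mp l : int) : 0 <= Mm + Mp -> - Mm <= l <= Mp ->
  size [seq k <- nodes Mm Mp | k != l] = stencil_order Mm Mp.
Proof.
move=> hM hl; rewrite -(rem_filter _ (nodes_uniq _ _)) size_rem ?mem_nodes //.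
by rewrite size_map size_iota.
Qed.

Lemma size_lagrange_interp (F : numFieldType) (Mm Mp l : int) :
  0 <= Mm + Mp -> - Mm <= l <= Mp ->
  size (lagrange_interp F Mm Mp l) = (stencil_order Mm Mp).+1.
Proof.
move=> hM hl; rewrite /lagrange_interp scaler_prod size_scale.
  by rewrite -big_filter size_prod_XsubC size_nodes_other.
rewrite prodf_seq_neq0; apply/allP => k _; apply/implyP => kl.
by rewrite invr_neq0 // intr_eq0 subr_eq0 eq_sym.
Qed.

Lemma lagrange_interp_node (F : fieldType) (Mm Mp l n : int) :
  0 <= Mm + Mp -> - Mm <= n <= Mp -> n != l ->
  (lagrange_interp F Mm Mp l).[n%:~R] = 0.
Proof.
move=> hM hn nl; rewrite /lagrange_interp (big_rem n) /= ?mem_nodes // nl.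
by rewrite hornerM hornerZ hornerXsubC subrr mulr0 mul0r.
Qed.

Lemma lagrange_reconstr_cell_root (R : rcfType) (Mm Mp l n : int) :
  0 <= Mm + Mp -> - Mm <= l <= Mp -> - Mm <= n <= Mp -> n != l ->
  {x : R | n%:~R - 2^-1 < x < n%:~R + 2^-1 &
           root (lagrange_reconstr R Mm Mp l) x}.
Proof.
move=> hM hl hn nl; set p := lagrange_reconstr _ _ _ _.
pose P := antideriv R p; set M := stencil_order Mm Mp.
have sq : size (lagrange_interp R Mm Mp l) = M.+1 by exact: size_lagrange_interp.
have pE : p = even_deconvol R (lagrange_interp R Mm Mp l) M.+1.
  by apply: lagrange_reconstrE; rewrite sq.
(* Integration raises the size to at most [M + 2], which is within [2 * (M + 1)] even for
   [M = 0]. *)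
have sP : (size P <= M.+1.*2)%N.
  apply: leq_trans (size_poly _ _) _.
  by have := size_poly M.+1 _ : (size p <= M.+1)%N; lia.
have eqP : P.[n%:~R - 2^-1] = P.[n%:~R + 2^-1].
  apply/esym/eqP; rewrite -subr_eq0 (cell_difference _ _ _ _ sP) deriv_antideriv pE.
  have := congr1 (horner^~ n%:~R) (cell_coef_even_deconvol _ _ _ (eq_leq sq)).
  rewrite lagrange_interp_node // horner_sum => sum0.
  by apply/eqP; rewrite -[RHS]sum0; apply: eq_bigr => k _; rewrite hornerZ.
have lt : n%:~R - 2^-1 < n%:~R + 2^-1 :> R by lra.
have [x hx px] := poly_rolle lt eqP.
by exists x; [rewrite in_itv /= in hx | rewrite /root -[p]deriv_antideriv px].
Qed.

(** At [m = M] only [k = 0] remains and [tau_0 = 1], so the leading coefficient is that of the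
    interpolation polynomial. *)
Lemma size_lagrange_reconstr (F : numFieldType) (Mm Mp l : int) :
  0 <= Mm + Mp -> - Mm <= l <= Mp ->
  size (lagrange_reconstr F Mm Mp l) = (stencil_order Mm Mp).+1.
Proof.
move=> hM hl; apply: size_poly_eq => /=; rewrite subnn big_ord1 muln0 addn0.
rewrite tau_even0 mul1r divff ?mul1r ?pnatr_eq0 -?lt0n ?fact_gt0 //.
have sq := size_lagrange_interp F _ _ _ hM hl.
by rewrite -[stencil_order _ _]/(_.+1.-1) -sq -lead_coefE lead_coef_eq0 -size_poly_eq0 sq.
Qed.

Lemma cell_inj (R : realFieldType) (m n : int) (x : R) :
  m%:~R - 2^-1 < x < m%:~R + 2^-1 -> n%:~R - 2^-1 < x < n%:~R + 2^-1 -> m = n.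
Proof.
wlog le_mn : m n / m <= n => [H hm hn|].
  by case: (leP m n) => [|/ltW] le; [|apply/esym]; apply: H.
move=> /andP[_ hm] /andP[hn _]; case: (ltgtP m n) le_mn => // lt _.
have : m%:~R + 1 <= n%:~R :> R by rewrite -[1]/(1%:~R) -intrD ler_int; lia.
by clear lt => le; exfalso; lra.
Qed.

Theorem proposition3p5 (R : realType) (Mm Mp : int) (hM : 0 <= Mm + Mp)
    (l : int) (hl : - Mm <= l <= Mp) :
  let M := stencil_order Mm Mp in
  let alpha : {poly R} := lagrange_reconstr R Mm Mp l in
  (* alpha has degree M *)
  size alpha = M.+1 /\
  (* its M complex roots are all real and distinct *)
  (exists rs : seq R,
     size rs = M /\ uniq rs /\
     map_poly (real_complex R) alpha =
       real_complex R (lead_coef alpha)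
         *: \prod_(x <- rs) ('X - (real_complex R x)%:P)) /\
  (* exactly one root in each interval *)
  (forall n : int, - Mm <= n <= Mp -> n != l ->
     exists! x : R,
       n%:~R - 2^-1 < x < n%:~R + 2^-1 /\ alpha.[x] = 0) /\
  (* no other real root *)
  (exists xi : int -> R,
     (forall n : int, - Mm <= n <= Mp -> n != l ->
        n%:~R - 2^-1 < xi n < n%:~R + 2^-1 /\ alpha.[xi n] = 0) /\
     (forall x : R,
        (forall n : int, - Mm <= n <= Mp -> n != l -> x <> xi n) ->
        alpha.[x] <> 0)).
Proof.
move=> M alpha.
have sz : size alpha = M.+1 by exact: size_lagrange_reconstr.
pose ns := [seq k <- nodes Mm Mp | k != l].
have nsE n : (n \in ns) = (n != l) && (- Mm <= n <= Mp).
  by rewrite mem_filter mem_nodes.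
have ex n : {x : R | n \in ns -> (n%:~R - 2^-1 < x < n%:~R + 2^-1) /\ root alpha x}.
  (* The value 0 outside [ns] is a dummy that makes [xi] total. *)
  case: (boolP (n \in ns)) => [|_]; last by exists 0.
  rewrite nsE => /andP[nl hn].
  by have [x] := lagrange_reconstr_cell_root R _ _ _ _ hM hl hn nl; exists x.
pose xi n := sval (ex n).
have xiP n : n \in ns -> n%:~R - 2^-1 < xi n < n%:~R + 2^-1 /\ root alpha (xi n).
  exact: (svalP (ex n)).
pose rs := [seq xi n | n <- ns].
have rs_uniq : uniq rs.
  rewrite map_inj_in_uniq ?filter_uniq ?nodes_uniq // => m n hm hn e.
  by apply: (cell_inj R m n (xi m)); [case: (xiP m hm) | rewrite e; case: (xiP n hn)].
have rs_size : size rs = M by rewrite size_map size_nodes_other.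
(* As many distinct roots as the degree force a complete factorisation over [R]; mapped to the
   complex numbers, it leaves no room for non-real roots. *)
have alphaE : alpha = lead_coef alpha *: \prod_(z <- rs) ('X - z%:P).
  apply: all_roots_prod_XsubC; rewrite ?sz ?rs_size ?uniq_rootsE //.
  by apply/allP => _ /mapP[n hn ->]; case: (xiP n hn).
have rootE x : root alpha x = (x \in rs).
  by rewrite alphaE rootZ ?root_prod_XsubC // lead_coef_eq0 -size_poly_eq0 sz.
do !split=> //.
- exists rs; do !split=> //.
  by rewrite {1}alphaE map_polyZ map_prod_XsubC.
- move=> n hn nl; have hns : n \in ns by rewrite nsE nl.
  have [hx rx] := xiP n hns.
  exists (xi n); split; first by split=> //; apply/rootP.
  (* Any other root in the cell of [n] is some [xi m], and disjointness of the cells gives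
     [m = n]. *)
  move=> y [hy /rootP]; rewrite rootE => /mapP[m hm ey].
  have [hxm _] := xiP m hm.
  by rewrite ey (cell_inj R n m y) // ey.
- exists xi; split.
    by move=> n hn nl; have [|? /rootP] := xiP n; rewrite ?nsE ?nl.
  move=> x hx /rootP; rewrite rootE => /mapP[n].
  by rewrite nsE => /andP[nl hn]; apply: hx.
Qed.
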